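(* Let $\theta\in(0,\pi)$ and let $f_\theta=h_\theta+\overline{g_\theta}\in S_H$ with $h_\theta(z)+g_\theta(z)=\dfrac{1}{2i\sin\theta}\log\!\left(\dfrac{1+ze^{i\theta}}{1+ze^{-i\theta}}\right)$ (principal branch, vanishing at $0$). Let $\alpha\in[-1,1]$ and let $f_\alpha=h_\alpha+\overline{g_\alpha}\in S_H$ with $h_\alpha(z)+g_\alpha(z)=\dfrac{z(1-\alpha z)}{1-z^2}$. Let $0\le t\le1$ and $f_{\theta,\alpha}=tf_\theta+(1-t)f_\alpha$. If $f_{\theta,\alpha}$ is locally univalent and sense-preserving in $E$, then $f_{\theta,\alpha}\in S_H$ and $f_{\theta,\alpha}$ maps $E$ onto a domain convex in the direction of the imaginary axis.
   Context: $E=\{z\in\mathbb{C}:|z|<1\}$. A harmonic mapping $f=h+\overline{g}$ on $E$ (with $h,g$ analytic) is locally univalent and sense-preserving iff $h'\neq0$ in $E$ and its dilatation $\omega=g'/h'$ satisfies $|\omega|<1$ in $E$. $S_H$ denotes the class of harmonic, univalent, sense-preserving mappings $f=h+\overline{g}$ of $E$ normalized by $f(0)=0$, $f_z(0)=1$. A domain $\Omega$ is convex in the direction of the imaginary axis if every line parallel to the imaginary axis has connected or empty intersection with $\Omega$. *)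

(* Defs.v *)
From Stdlib Require Import Reals Lra.
Open Scope R_scope.

Definition Cplx := (R * R)%type.
Definition Re (z : Cplx) : R := fst z.
Definition Im (z : Cplx) : R := snd z.
Definition RtoC (x : R) : Cplx := (x, 0).
Definition Ci : Cplx := (0, 1).
Definition Cadd (z w : Cplx) : Cplx := (Re z + Re w, Im z + Im w).
Definition Copp (z : Cplx) : Cplx := (- Re z, - Im z).
Definition Csub (z w : Cplx) : Cplx := Cadd z (Copp w).
Definition Cmul (z w : Cplx) : Cplx :=
  (Re z * Re w - Im z * Im w, Re z * Im w + Im z * Re w).
Definition Cinv (z : Cplx) : Cplx :=
  (Re z / (Re z ^ 2 + Im z ^ 2), - Im z / (Re z ^ 2 + Im z ^ 2)).
Definition Cdiv (z w : Cplx) : Cplx := Cmul z (Cinv w).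
Definition Cconj (z : Cplx) : Cplx := (Re z, - Im z).
Definition Cnorm (z : Cplx) : R := sqrt (Re z ^ 2 + Im z ^ 2).
Definition Cexpi (x : R) : Cplx := (cos x, sin x).

(* principal argument in (-PI, PI] (value 0 at 0) *)
Definition Carg (z : Cplx) : R :=
  let x := Re z in let y := Im z in
  if Rlt_dec 0 x then atan (y / x)
  else if Rlt_dec x 0 then
    (if Rle_dec 0 y then atan (y / x) + PI else atan (y / x) - PI)
  else if Rlt_dec 0 y then PI / 2
  else if Rlt_dec y 0 then - (PI / 2) else 0.

Definition Clog (z : Cplx) : Cplx := (ln (Cnorm z), Carg z).

Definition inE (z : Cplx) : Prop := Cnorm z < 1.

Definition has_cderiv (f : Cplx -> Cplx) (z d : Cplx) : Prop :=
  forall eps : R, 0 < eps -> exists delta : R, 0 < delta /\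
    forall w : Cplx, 0 < Cnorm (Csub w z) < delta ->
      Cnorm (Csub (Cdiv (Csub (f w) (f z)) (Csub w z)) d) < eps.

Definition analytic_on_E (f : Cplx -> Cplx) : Prop :=
  forall z, inE z -> exists d, has_cderiv f z d.

Definition harm (h g : Cplx -> Cplx) : Cplx -> Cplx := fun z => Cadd (h z) (Cconj (g z)).

Definition loc_univ_sense_pres (h g : Cplx -> Cplx) : Prop :=
  analytic_on_E h /\ analytic_on_E g /\
  forall z a b, inE z -> has_cderiv h z a -> has_cderiv g z b ->
    a <> (0, 0) /\ Cnorm (Cdiv b a) < 1.

Definition in_SH (h g : Cplx -> Cplx) : Prop :=
  loc_univ_sense_pres h g /\
  (forall z1 z2, inE z1 -> inE z2 -> harm h g z1 = harm h g z2 -> z1 = z2) /\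
  harm h g (0, 0) = (0, 0) /\
  has_cderiv h (0, 0) (1, 0).

Definition image_E (F : Cplx -> Cplx) (w : Cplx) : Prop := exists z, inE z /\ F z = w.

Definition open_set (O : Cplx -> Prop) : Prop :=
  forall w, O w -> exists r, 0 < r /\ forall v, Cnorm (Csub v w) < r -> O v.

Definition path_connected (O : Cplx -> Prop) : Prop :=
  forall w1 w2, O w1 -> O w2 -> exists p : R -> Cplx,
    p 0 = w1 /\ p 1 = w2 /\
    (forall s, 0 <= s <= 1 -> O (p s)) /\
    (forall s, 0 <= s <= 1 -> continuity_pt (fun u => Re (p u)) s /\
                               continuity_pt (fun u => Im (p u)) s).

Definition domain (O : Cplx -> Prop) : Prop :=
  open_set O /\ path_connected O /\ exists w, O w.

Definition convex_imag_dir (O : Cplx -> Prop) : Prop :=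
  forall w1 w2, O w1 -> O w2 -> Re w1 = Re w2 ->
    forall y, Rmin (Im w1) (Im w2) <= y <= Rmax (Im w1) (Im w2) -> O (Re w1, y).

Definition F_theta (th : R) (z : Cplx) : Cplx :=
  Cmul (Cinv (Cmul (2, 0) (Cmul Ci (RtoC (sin th)))))
       (Clog (Cdiv (Cadd (1, 0) (Cmul z (Cexpi th)))
                   (Cadd (1, 0) (Cmul z (Cexpi (- th)))))).

Definition F_alpha (al : R) (z : Cplx) : Cplx :=
  Cdiv (Cmul z (Csub (1, 0) (Cmul (RtoC al) z))) (Csub (1, 0) (Cmul z z)).

Definition comb (t : R) (u v : Cplx -> Cplx) : Cplx -> Cplx :=
  fun z => Cadd (Cmul (RtoC t) (u z)) (Cmul (RtoC (1 - t)) (v z)).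

(* Main.v *)
(** Write p = (1+z)/(1-z) for the Cayley image of z in the right half-plane, and p = x(1+im)
    with x > 0.  Since f = h + conj g has Re f = Re (h+g), the function u = Re f is known
    explicitly: with y = |p|^2 / Re p = x(1+m^2), it is an increasing function of (x, y).
    Hence u increases strictly along each ray m = const and has the same range on all of
    them, so every level line of u is a graph x = rho(m) over the whole line.  Along such a
    line Im f = Im (h-g) is strictly increasing in m, because |g'| < |h'|.  So f maps each
    level line injectively onto a vertical segment, which yields univalence and convexity in
    the direction of the imaginary axis, and the openness of the image by the intermediate
    value theorem. *)
From Coquelicot Require Import Coquelicot.
From Stdlib Require Import Lra IndefiniteDescription.
Require Import Defs.
From Stdlib Require Import Reals.
Open Scope R_scope.

(** * Level foliations of a half-plane *)

(* The level lines of [u] cross every line [m = const] exactly once, and [k] increases with [m]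
   along them; [fol_turn] asserts the latter only infinitesimally. *)
Record level_foliation (u k : R -> R -> R) : Prop := {
  fol_cont_u : forall x m, 0 < x -> continuity_2d_pt u x m;
  fol_cont_k : forall x m, 0 < x -> continuity_2d_pt k x m;
  fol_incr : forall m x1 x2, 0 < x1 < x2 -> u x1 m < u x2 m;
  fol_full : forall x m m', 0 < x -> exists x', 0 < x' /\ u x' m' = u x m;
  fol_turn : forall x0 m0, 0 < x0 ->
    locally_2d (fun x m => u x m = u x0 m0 -> m <> m0 ->
                           0 < (k x m - k x0 m0) * (m - m0)) x0 m0 }.

Lemma continuity_2d_pt_comp (f : R -> R -> R) (a b : R -> R) (s : R) :
  continuity_pt a s -> continuity_pt b s -> continuity_2d_pt f (a s) (b s) ->
  continuity_pt (fun v => f (a v) (b v)) s.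
Proof.
intros Ha Hb Hf; apply continuity_pt_locally; intros eps.
destruct (Hf eps) as [d Hd].
apply (filter_imp _ _ (fun v H => Hd (a v) (b v) (proj1 H) (proj2 H))).
apply filter_and; [apply (proj1 (continuity_pt_locally a s)) |
                   apply (proj1 (continuity_pt_locally b s))]; assumption.
Qed.

(** The substitution [x = exp s] turns continuity on the open half-line into continuity on the whole
    line, where [IVT_gen] applies. *)
Lemma ivt_positive (f : R -> R) (a b c : R) :
  0 < a <= b -> (forall x, 0 < x -> continuity_pt f x) -> f a <= c <= f b ->
  exists x, a <= x <= b /\ f x = c.
Proof.
intros Hab Hf Hc.
assert (Hln : ln a <= ln b).
{ destruct (proj2 Hab) as [H | H]; [left; apply ln_increasing; lra | rewrite H; lra]. }
destruct (IVT_gen (fun s => f (exp s)) (ln a) (ln b) c) as [s [Hs Es]].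
- intros s; apply (continuity_pt_comp exp f).
  + apply derivable_continuous_pt, derivable_pt_exp.
  + apply Hf, exp_pos.
- rewrite !exp_ln by lra; rewrite Rmin_left, Rmax_right by lra; exact Hc.
- rewrite Rmin_left, Rmax_right in Hs by exact Hln.
  exists (exp s); split; [| exact Es].
  rewrite <- (exp_ln a), <- (exp_ln b) by lra.
  split; [destruct (proj1 Hs) as [H | H] | destruct (proj2 Hs) as [H | H]];
    try (left; apply exp_increasing; exact H); rewrite H; lra.
Qed.

(** Let [c] be the supremum of the [v <= b] up to which [f] stays above [f a]. Local increase at [c]
    gives [f a < f c] when [a < c], and then carries the property past [c] unless [c = b]. *)
Lemma locally_increasing_increasing (f : R -> R) :
  (forall s, locally s (fun v => v <> s -> 0 < (f v - f s) * (v - s))) ->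
  forall a b, a < b -> f a < f b.
Proof.
intros Hloc a b Hab.
assert (Hloc' : forall s, exists d, 0 < d /\ forall v, Rabs (v - s) < d ->
          (s < v -> f s < f v) /\ (v < s -> f v < f s)).
{ intros s; destruct (Hloc s) as [d Hd]; exists d; split; [apply cond_pos |].
  intros v Hv; specialize (Hd v Hv); split; intros Hlt;
    specialize (Hd ltac:(lra)); nra. }
set (S := fun v => v <= b /\ forall y, a < y <= v -> f a < f y).
destruct (completeness S) as [c [Hub Hlub]].
- exists b; intros v Hv; apply Hv.
- exists a; split; [lra | intros y Hy; lra].
- assert (Hac : a <= c) by (apply Hub; split; [lra | intros y Hy; lra]).
  assert (Hcb : c <= b) by (apply Hlub; intros v Hv; apply Hv).
  assert (Hbelow : forall y, a < y < c -> f a < f y).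
  { intros y Hy; apply Rnot_le_lt; intros Hle.
    apply (Rlt_not_le c y); [lra |]; apply Hlub; intros v [_ Hv].
    apply Rnot_lt_le; intros Hyv; specialize (Hv y ltac:(lra)); lra. }
  destruct (Hloc' c) as [d [Hd Hdc]].
  assert (Hfc : a < c -> f a < f c).
  (* This [y] lies between [a] and [c] and within [d] of [c], so that [f a < f y < f c]. *)
  { intros Hlt; set (y := Rmax ((a + c) / 2) (c - d / 2)).
    assert (Hy : (a + c) / 2 <= y /\ c - d / 2 <= y)
      by (split; [apply Rmax_l | apply Rmax_r]).
    assert (Hy' : y < c) by (apply Rmax_lub_lt; lra).
    apply Rlt_trans with (f y); [apply Hbelow; lra |].
    apply (Hdc y); [apply Rabs_def1; lra | exact Hy']. }
  destruct (Rle_lt_or_eq_dec c b Hcb) as [Hlt | ->]; [| exact (Hfc Hab)].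
  exfalso; set (v := Rmin b (c + d / 2)).
  assert (Hv : v <= b /\ v <= c + d / 2) by (split; [apply Rmin_l | apply Rmin_r]).
  assert (Hcv : c < v) by (apply Rmin_glb_lt; lra).
  apply (Rlt_not_le v c Hcv); apply Hub; split; [lra |].
  intros y Hy.
  destruct (Rtotal_order y c) as [H | [-> | H]].
  + apply Hbelow; lra.
  + apply Hfc; lra.
  + assert (Hyc : f c < f y) by (apply (Hdc y); [apply Rabs_def1; lra | exact H]).
    destruct (Rle_lt_or_eq_dec a c Hac) as [Ha | ->]; [specialize (Hfc Ha) |]; lra.
Qed.

(** [fol_full] provides a point of the level on each ray and [fol_incr] makes it unique, so the
    level line is a graph [rho]. Along it [fol_turn] becomes local increase of [k], which
    [locally_increasing_increasing] makes global. *)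
Lemma foliation_level_curve (u k : R -> R -> R) (x0 m0 : R) :
  level_foliation u k -> 0 < x0 ->
  exists rho : R -> R,
    (forall m, 0 < rho m /\ u (rho m) m = u x0 m0) /\
    (forall m, continuity_pt rho m) /\
    (forall m x, 0 < x -> u x m = u x0 m0 -> x = rho m) /\
    (forall m1 m2, m1 < m2 -> k (rho m1) m1 < k (rho m2) m2).
Proof.
intros Hfol Hx0.
destruct (functional_choice _ (fun m => fol_full u k Hfol x0 m0 m Hx0)) as [rho Hrho].
exists rho.
assert (Hcont : forall m, continuity_pt rho m).
{ intros m; apply continuity_pt_locally; intros eps.
  destruct (Hrho m) as [Hpos Hlev].
  (* The bound [rho m / 2] keeps [rho m - e] positive. At [rho m - e] and [rho m + e] the value of
     [u] is strictly on either side of the level; this persists for [v] near [m] and traps [rho v]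
     in between. *)
  set (e := Rmin (eps / 2) (rho m / 2)).
  pose proof (cond_pos eps).
  assert (He : 0 < e) by (apply Rmin_glb_lt; lra).
  assert (He' : e <= eps / 2 /\ e <= rho m / 2) by (split; [apply Rmin_l | apply Rmin_r]).
  assert (H1 : u (rho m - e) m < u x0 m0)
    by (rewrite <- Hlev; apply (fol_incr u k Hfol); lra).
  assert (H2 : u x0 m0 < u (rho m + e) m)
    by (rewrite <- Hlev; apply (fol_incr u k Hfol); lra).
  destruct (fol_cont_u u k Hfol (rho m - e) m ltac:(lra)
              (mkposreal _ (proj2 (Rlt_0_minus _ _) H1))) as [d1 Hd1].
  destruct (fol_cont_u u k Hfol (rho m + e) m ltac:(lra)
              (mkposreal _ (proj2 (Rlt_0_minus _ _) H2))) as [d2 Hd2].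
  simpl in Hd1, Hd2.
  assert (Hd : 0 < Rmin d1 d2) by (apply Rmin_glb_lt; apply cond_pos).
  exists (mkposreal _ Hd); intros v Hv.
  assert (Hv' : Rabs (v - m) < Rmin d1 d2) by exact Hv.
  specialize (Hd1 (rho m - e) v); specialize (Hd2 (rho m + e) v).
  rewrite Rminus_diag, Rabs_R0 in Hd1, Hd2.
  specialize (Hd1 (cond_pos _) (Rlt_le_trans _ _ _ Hv' (Rmin_l _ _))).
  specialize (Hd2 (cond_pos _) (Rlt_le_trans _ _ _ Hv' (Rmin_r _ _))).
  apply Rabs_def2 in Hd1; apply Rabs_def2 in Hd2.
  destruct (Hrho v) as [Hvpos Hvlev].
  assert (rho m - e < rho v).
  { apply Rnot_le_lt; intros [Hlt | Heq].
    - pose proof (fol_incr u k Hfol v (rho v) (rho m - e) ltac:(lra)); lra.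
    - rewrite Heq in Hvlev; lra. }
  assert (rho v < rho m + e).
  { apply Rnot_le_lt; intros [Hlt | Heq].
    - pose proof (fol_incr u k Hfol v (rho m + e) (rho v) ltac:(lra)); lra.
    - rewrite <- Heq in Hvlev; lra. }
  apply Rabs_def1; lra. }
split; [exact Hrho | split; [exact Hcont | split]].
- intros m x Hx Hlev; destruct (Hrho m) as [Hpos Hm].
  destruct (Rtotal_order x (rho m)) as [H | [H | H]]; [| exact H |].
  + pose proof (fol_incr u k Hfol m x (rho m) ltac:(lra)); lra.
  + pose proof (fol_incr u k Hfol m (rho m) x ltac:(lra)); lra.
- apply (locally_increasing_increasing (fun m => k (rho m) m)); intros s.
  destruct (Hrho s) as [Hpos Hs].
  destruct (fol_turn u k Hfol (rho s) s Hpos) as [d Hd].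
  generalize (filter_and _ _ (proj1 (continuity_pt_locally rho s) (Hcont s) d)
                             (locally_ball s d)).
  apply filter_imp; intros v [Hr Hv] Hne.
  apply Hd; [exact Hr | exact Hv | rewrite Hs; apply Hrho | exact Hne].
Qed.

(** Points with equal [u] lie on one level curve, where [k] is strictly increasing in [m]. *)
Lemma foliation_injective (u k : R -> R -> R) (x1 m1 x2 m2 : R) :
  level_foliation u k -> 0 < x1 -> 0 < x2 ->
  u x1 m1 = u x2 m2 -> k x1 m1 = k x2 m2 -> x1 = x2 /\ m1 = m2.
Proof.
intros Hfol Hx1 Hx2 Hu Hk.
destruct (foliation_level_curve u k x1 m1 Hfol Hx1) as [rho [_ [_ [Huniq Hinc]]]].
pose proof (Huniq m1 x1 Hx1 eq_refl) as E1.
pose proof (Huniq m2 x2 Hx2 (eq_sym Hu)) as E2.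
rewrite E1, E2 in Hk.
destruct (Rtotal_order m1 m2) as [H | [H | H]].
- specialize (Hinc m1 m2 H); lra.
- split; [rewrite E1, E2, H; reflexivity | exact H].
- specialize (Hinc m2 m1 H); lra.
Qed.

(** Both points lie on one continuous level curve, so the intermediate value theorem applies to [k]
    along it. *)
Lemma foliation_vertical_convex (u k : R -> R -> R) (x1 m1 x2 m2 y : R) :
  level_foliation u k -> 0 < x1 -> 0 < x2 -> u x1 m1 = u x2 m2 ->
  Rmin (k x1 m1) (k x2 m2) <= y <= Rmax (k x1 m1) (k x2 m2) ->
  exists x m, 0 < x /\ u x m = u x1 m1 /\ k x m = y.
Proof.
intros Hfol Hx1 Hx2 Hu Hy.
destruct (foliation_level_curve u k x1 m1 Hfol Hx1) as [rho [Hrho [Hcont [Huniq _]]]].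
rewrite (Huniq m1 x1 Hx1 eq_refl), (Huniq m2 x2 Hx2 (eq_sym Hu)) in Hy.
destruct (IVT_gen (fun m => k (rho m) m) m1 m2 y) as [m [_ Hm]]; [| exact Hy |].
- intros m; apply (continuity_2d_pt_comp k rho (fun v => v)).
  + apply Hcont.
  + apply derivable_continuous_pt, derivable_pt_id.
  + apply (fol_cont_k u k Hfol), Hrho.
- exists (rho m), m; split; [apply Hrho | split; [apply Hrho | exact Hm]].
Qed.

(** Since [u] is strictly increasing and continuous on the ray, levels close to [u x0 m] are
    attained on it close to [x0], where continuity of [k] bounds its change. *)
Lemma foliation_solve_nearby (u k : R -> R -> R) (x0 m : R) (eta : R) :
  level_foliation u k -> 0 < x0 -> 0 < eta ->
  exists r, 0 < r /\ forall c, Rabs (c - u x0 m) < r ->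
    exists x, 0 < x /\ u x m = c /\ Rabs (k x m - k x0 m) < eta.
Proof.
intros Hfol Hx0 Heta.
destruct (fol_cont_k u k Hfol x0 m Hx0 (mkposreal _ Heta)) as [d Hd]; simpl in Hd.
pose proof (cond_pos d) as Hdpos.
set (e := Rmin (d / 2) (x0 / 2)).
assert (He : 0 < e) by (apply Rmin_glb_lt; lra).
assert (He' : e <= d / 2 /\ e <= x0 / 2) by (split; [apply Rmin_l | apply Rmin_r]).
pose proof (fol_incr u k Hfol m (x0 - e) x0 ltac:(lra)) as H1.
pose proof (fol_incr u k Hfol m x0 (x0 + e) ltac:(lra)) as H2.
exists (Rmin (u x0 m - u (x0 - e) m) (u (x0 + e) m - u x0 m)).
split; [apply Rmin_glb_lt; lra |]; intros c Hc.
pose proof (Rlt_le_trans _ _ _ Hc (Rmin_l _ _)) as Hc1.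
pose proof (Rlt_le_trans _ _ _ Hc (Rmin_r _ _)) as Hc2.
apply Rabs_def2 in Hc1; apply Rabs_def2 in Hc2.
destruct (ivt_positive (fun x => u x m) (x0 - e) (x0 + e) c) as [x [Hx Hux]].
- lra.
- intros x Hx; apply (continuity_2d_pt_comp u (fun v => v) (fun _ => m)).
  + apply derivable_continuous_pt, derivable_pt_id.
  + apply continuity_pt_const; intros ? ?; reflexivity.
  + apply (fol_cont_u u k Hfol); exact Hx.
- lra.
- exists x; split; [lra | split; [exact Hux |]].
  apply Hd; [apply Rabs_def1; lra | rewrite Rminus_diag, Rabs_R0; exact Hdpos].
Qed.

(** The level line through the point takes values of [k] strictly below and strictly above [k x0 m0]
    on the rays [m0 - 1] and [m0 + 1]. A nearby level line meets these two rays with almost the same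
    values of [k], hence still brackets [y], and vertical convexity supplies the point. *)
Lemma foliation_open (u k : R -> R -> R) (x0 m0 : R) :
  level_foliation u k -> 0 < x0 ->
  exists r, 0 < r /\ forall c y, Rabs (c - u x0 m0) < r -> Rabs (y - k x0 m0) < r ->
    exists x m, 0 < x /\ u x m = c /\ k x m = y.
Proof.
intros Hfol Hx0.
destruct (foliation_level_curve u k x0 m0 Hfol Hx0) as [rho [Hrho [_ [Huniq Hinc]]]].
set (m1 := m0 - 1); set (m2 := m0 + 1).
destruct (Hrho m1) as [Hp1 Hl1]; destruct (Hrho m2) as [Hp2 Hl2].
assert (Hk1 : k (rho m1) m1 < k x0 m0)
  by (rewrite (Huniq m0 x0 Hx0 eq_refl); apply Hinc; unfold m1; lra).
assert (Hk2 : k x0 m0 < k (rho m2) m2)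
  by (rewrite (Huniq m0 x0 Hx0 eq_refl); apply Hinc; unfold m2; lra).
(* Half of each gap is left for the error of [k] at the end of the level line and half for the
   deviation of [y]. *)
set (eta := Rmin ((k x0 m0 - k (rho m1) m1) / 2) ((k (rho m2) m2 - k x0 m0) / 2)).
assert (Heta : 0 < eta) by (apply Rmin_glb_lt; lra).
assert (Heta' : eta <= (k x0 m0 - k (rho m1) m1) / 2 /\ eta <= (k (rho m2) m2 - k x0 m0) / 2)
  by (split; [apply Rmin_l | apply Rmin_r]).
destruct (foliation_solve_nearby u k (rho m1) m1 eta Hfol Hp1 Heta) as [r1 [Hr1 Hs1]].
destruct (foliation_solve_nearby u k (rho m2) m2 eta Hfol Hp2 Heta) as [r2 [Hr2 Hs2]].
rewrite Hl1 in Hs1; rewrite Hl2 in Hs2.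
exists (Rmin eta (Rmin r1 r2)); split; [apply Rmin_glb_lt; [| apply Rmin_glb_lt]; assumption |].
intros c y Hc Hy.
pose proof (Rlt_le_trans _ _ _ Hy (Rmin_l _ _)) as Hy'.
pose proof (Rlt_le_trans _ _ _ Hc (Rmin_r _ _)) as Hc'.
destruct (Hs1 c (Rlt_le_trans _ _ _ Hc' (Rmin_l _ _))) as [x1 [Hx1 [Hu1 Hkx1]]].
destruct (Hs2 c (Rlt_le_trans _ _ _ Hc' (Rmin_r _ _))) as [x2 [Hx2 [Hu2 Hkx2]]].
apply Rabs_def2 in Hy'; apply Rabs_def2 in Hkx1; apply Rabs_def2 in Hkx2.
rewrite <- Hu1; apply (foliation_vertical_convex u k x1 m1 x2 m2 y); try assumption.
- lra.
- rewrite Rmin_left, Rmax_right by lra; lra.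
Qed.

(** * Half-plane coordinates on the disk *)

Definition hp_den (x m : R) : R := x ^ 2 * (1 + m ^ 2) + 2 * x + 1.

(* (p - 1) / (p + 1) for p = x (1 + i m), where [hp_den x m] is |p + 1|^2. *)
Definition hp_disk (x m : R) : Cplx :=
  ((x ^ 2 * (1 + m ^ 2) - 1) / hp_den x m, 2 * x * m / hp_den x m).

Lemma hp_den_pos (x m : R) : 0 < x -> 0 < hp_den x m.
Proof. intros Hx; unfold hp_den; nra. Qed.

Lemma hp_disk_norm (x m : R) : 0 < x ->
  1 - (Re (hp_disk x m) ^ 2 + Im (hp_disk x m) ^ 2) = 4 * x / hp_den x m.
Proof.
intros Hx; pose proof (hp_den_pos x m Hx) as Hd.
unfold Re, Im, hp_disk; simpl fst; simpl snd; unfold hp_den in *; field; lra.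
Qed.

Lemma inE_sqr (z : Cplx) : inE z <-> Re z ^ 2 + Im z ^ 2 < 1.
Proof.
unfold inE, Cnorm; rewrite <- sqrt_1 at 1; split.
- intros H; apply sqrt_lt_0_alt; exact H.
- intros H; apply sqrt_lt_1_alt; split; [nra | exact H].
Qed.

Lemma hp_disk_inE (x m : R) : 0 < x -> inE (hp_disk x m).
Proof.
intros Hx; apply inE_sqr.
pose proof (hp_disk_norm x m Hx) as H.
assert (0 < 4 * x / hp_den x m) by (apply Rdiv_lt_0_compat; [lra | apply hp_den_pos; exact Hx]).
lra.
Qed.

Lemma hp_disk_surj (z : Cplx) : inE z -> exists x m, 0 < x /\ hp_disk x m = z.
Proof.
destruct z as [a b]; intros Hz; apply inE_sqr in Hz; unfold Re, Im in Hz.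
simpl fst in Hz; simpl snd in Hz.
assert (Hd : 0 < (1 - a) ^ 2 + b ^ 2) by nra.
(* With [p = (1 + z) / (1 - z)], these are [x = Re p] and [m = Im p / Re p]; below, [Hq] computes
   [|p|^2] and [Hxm] computes [Im p]. *)
set (x := (1 - a ^ 2 - b ^ 2) / ((1 - a) ^ 2 + b ^ 2)).
set (m := 2 * b / (1 - a ^ 2 - b ^ 2)).
assert (Hx : 0 < x) by (apply Rdiv_lt_0_compat; lra).
exists x, m; split; [exact Hx |].
pose proof (hp_den_pos x m Hx) as Hden.
assert (Hq : x ^ 2 * (1 + m ^ 2) = ((1 + a) ^ 2 + b ^ 2) / ((1 - a) ^ 2 + b ^ 2))
  by (unfold x, m; field; lra).
assert (Hxm : x * m = 2 * b / ((1 - a) ^ 2 + b ^ 2)) by (unfold x, m; field; lra).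
assert (Hde : hp_den x m = 4 / ((1 - a) ^ 2 + b ^ 2))
  by (unfold hp_den; rewrite Hq; unfold x; field; lra).
unfold hp_disk; rewrite Hde, Hq.
replace (2 * x * m) with (2 * (x * m)) by ring; rewrite Hxm.
f_equal; field; lra.
Qed.

(* p / p0 - 1 *)
Definition hp_ratio (x0 m0 x m : R) : Cplx :=
  (x * (1 + m * m0) / (x0 * (1 + m0 ^ 2)) - 1, x * (m - m0) / (x0 * (1 + m0 ^ 2))).

(* 2 p0 / ((p + 1) (p0 + 1)) *)
Definition hp_slope (x0 m0 x m : R) : Cplx :=
  Cmul ((x0 ^ 2 * (1 + m0 ^ 2) + x0) / hp_den x0 m0, x0 * m0 / hp_den x0 m0)
       (2 * (x + 1) / hp_den x m, - (2 * x * m) / hp_den x m).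

(** This is [(p - 1) / (p + 1) - (p0 - 1) / (p0 + 1) = 2 (p - p0) / ((p + 1) (p0 + 1))], with [p0]
    moved from the ratio into the slope. *)
Lemma hp_disk_sub (x0 m0 x m : R) : 0 < x0 -> 0 < x ->
  Csub (hp_disk x m) (hp_disk x0 m0) = Cmul (hp_slope x0 m0 x m) (hp_ratio x0 m0 x m).
Proof.
intros Hx0 Hx.
pose proof (hp_den_pos x0 m0 Hx0) as Hd0; pose proof (hp_den_pos x m Hx) as Hd.
assert (Hm : 0 < 1 + m0 ^ 2) by nra.
unfold Csub, Cadd, Copp, Cmul, hp_slope, Cmul, hp_ratio, hp_disk, Re, Im; simpl fst; simpl snd.
unfold hp_den in *; f_equal; field; repeat split; lra.
Qed.

Ltac continuity_2d :=
  repeat first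
    [ apply continuity_2d_pt_const | apply continuity_2d_pt_id1 | apply continuity_2d_pt_id2
    | apply continuity_2d_pt_plus | apply continuity_2d_pt_minus
    | apply continuity_2d_pt_opp | apply continuity_2d_pt_mult
    | apply continuity_2d_pt_inv ].

Lemma hp_den_continuous (x m : R) : continuity_2d_pt hp_den x m.
Proof. unfold hp_den; simpl pow; continuity_2d. Qed.

Lemma hp_disk_continuous (x m : R) : 0 < x ->
  continuity_2d_pt (fun v w => Re (hp_disk v w)) x m /\
  continuity_2d_pt (fun v w => Im (hp_disk v w)) x m.
Proof.
intros Hx; pose proof (hp_den_pos x m Hx).
unfold hp_disk, Re, Im, Rdiv; simpl; split; continuity_2d;
  first [apply hp_den_continuous | lra].
Qed.

Lemma hp_slope_continuous (x0 m0 x m : R) : 0 < x ->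
  continuity_2d_pt (fun v w => Re (hp_slope x0 m0 v w)) x m /\
  continuity_2d_pt (fun v w => Im (hp_slope x0 m0 v w)) x m.
Proof.
intros Hx; pose proof (hp_den_pos x m Hx).
unfold hp_slope, Cmul, Re, Im, Rdiv; simpl; split; continuity_2d;
  first [apply hp_den_continuous | lra].
Qed.

(** On the diagonal the slope is [2 p / (p + 1)^2], the derivative of the Cayley map with respect to
    [log p]. Its squared modulus is the factor by which [|h'|^2 - |g'|^2] changes in these
    coordinates. *)
Lemma hp_slope_neq0 (x m : R) : 0 < x -> 
  0 < Re (hp_slope x m x m) ^ 2 + Im (hp_slope x m x m) ^ 2.
Proof.
intros Hx; pose proof (hp_den_pos x m Hx) as Hd.
replace (_ + _) with (4 * (x ^ 2 * (1 + m ^ 2)) / hp_den x m ^ 2).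
- apply Rdiv_lt_0_compat; nra.
- unfold hp_slope, Cmul, Re, Im, Rdiv; simpl fst; simpl snd; unfold hp_den in *; field; lra.
Qed.

(** * Complex differentiability in half-plane coordinates *)

Lemma Cnorm_bounds (z : Cplx) :
  Rabs (Re z) <= Cnorm z /\ Rabs (Im z) <= Cnorm z /\
  Cnorm z <= Rabs (Re z) + Rabs (Im z).
Proof.
split; [| split].
- exact (Rle_trans _ _ _ (Rmax_l _ _) (Rmax_Cmod z)).
- exact (Rle_trans _ _ _ (Rmax_r _ _) (Rmax_Cmod z)).
- unfold Cnorm; rewrite <- (pow2_abs (Re z)), <- (pow2_abs (Im z)).
  pose proof (Rabs_pos (Re z)); pose proof (Rabs_pos (Im z)).
  rewrite <- (sqrt_pow2 (Rabs (Re z) + Rabs (Im z))) by lra.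
  apply sqrt_le_1_alt; nra.
Qed.

Lemma Cplx_eq_dec (z w : Cplx) : {z = w} + {z <> w}.
Proof. exact (Ceq_dec z w). Qed.

Lemma Cnorm_gt0 (z : Cplx) : z <> (0, 0) -> 0 < Cnorm z.
Proof. exact (proj1 (Cmod_gt_0 z)). Qed.

Lemma Csub_neq0 (z w : Cplx) : z <> w -> Csub z w <> (0, 0).
Proof.
intros H E; apply H; destruct z as [a b], w as [a' b'].
unfold Csub, Cadd, Copp, Re, Im in E; simpl in E; injection E; intros; f_equal; lra.
Qed.

(* Caratheodory's form of differentiability.  The increment is measured by p / p0 - 1 because
   its imaginary part has exactly the sign of m - m0. *)
Lemma has_cderiv_hp_disk (f : Cplx -> Cplx) (x0 m0 : R) (d : Cplx) :
  0 < x0 -> has_cderiv f (hp_disk x0 m0) d ->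
  exists q1 q2 : R -> R -> R,
    continuity_2d_pt q1 x0 m0 /\ continuity_2d_pt q2 x0 m0 /\
    (q1 x0 m0, q2 x0 m0) = Cmul d (hp_slope x0 m0 x0 m0) /\
    forall x m, 0 < x ->
      Csub (f (hp_disk x m)) (f (hp_disk x0 m0)) = Cmul (q1 x m, q2 x m) (hp_ratio x0 m0 x m).
Proof.
intros Hx0 Hd; set (z0 := hp_disk x0 m0) in *.
(* The difference quotient, completed by its limit [d] at [z0], is continuous along [hp_disk] at
   [(x0, m0)]. *)
set (Q := fun z => if Cplx_eq_dec z z0 then d else Cdiv (Csub (f z) (f z0)) (Csub z z0)).
assert (HQ0 : Q z0 = d) by (unfold Q; destruct (Cplx_eq_dec z0 z0); [reflexivity | contradiction]).
assert (HQ : forall z, Csub (f z) (f z0) = Cmul (Q z) (Csub z z0)).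
{ intros z; unfold Q; destruct (Cplx_eq_dec z z0) as [-> | Hne].
  - unfold Csub, Cadd, Copp, Cmul, Re, Im; simpl; f_equal; ring.
  - pose proof (Csub_neq0 z z0 Hne) as Hn.
    change (Cminus (f z) (f z0) =
            Cmult (Complex.Cdiv (Cminus (f z) (f z0)) (Cminus z z0)) (Cminus z z0)).
    field; exact Hn. }
assert (HQc : forall eps : posreal, locally_2d
          (fun x m => Cnorm (Csub (Q (hp_disk x m)) (Q z0)) < eps) x0 m0).
{ intros eps; destruct (Hd eps (cond_pos eps)) as [delta [Hdelta Hlim]].
  destruct (hp_disk_continuous x0 m0 Hx0) as [C1 C2].
  assert (Hhalf : 0 < delta / 2) by lra.
  generalize (locally_2d_and _ _ _ _ (C1 (mkposreal _ Hhalf)) (C2 (mkposreal _ Hhalf))).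
  apply locally_2d_impl, locally_2d_forall; intros x m [H1 H2].
  rewrite HQ0; unfold Q; destruct (Cplx_eq_dec (hp_disk x m) z0) as [_ | Hne].
  - replace (Csub d d) with ((0, 0) : Cplx)
      by (unfold Csub, Cadd, Copp, Re, Im; simpl; f_equal; ring).
    change (Cmod 0 < eps); rewrite Cmod_0; apply cond_pos.
  - apply Hlim; split; [apply Cnorm_gt0, Csub_neq0, Hne |].
    destruct (Cnorm_bounds (Csub (hp_disk x m) z0)) as [_ [_ H]].
    change (Rabs (Re (Csub (hp_disk x m) z0)) < delta / 2) in H1.
    change (Rabs (Im (Csub (hp_disk x m) z0)) < delta / 2) in H2.
    lra. }
assert (HQ1 : continuity_2d_pt (fun x m => Re (Q (hp_disk x m))) x0 m0).
{ intros eps; generalize (HQc eps).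
  apply locally_2d_impl, locally_2d_forall; intros x m H; fold z0.
  exact (Rle_lt_trans _ _ _ (proj1 (Cnorm_bounds (Csub (Q (hp_disk x m)) (Q z0)))) H). }
assert (HQ2 : continuity_2d_pt (fun x m => Im (Q (hp_disk x m))) x0 m0).
{ intros eps; generalize (HQc eps).
  apply locally_2d_impl, locally_2d_forall; intros x m H; fold z0.
  exact (Rle_lt_trans _ _ _
           (proj1 (proj2 (Cnorm_bounds (Csub (Q (hp_disk x m)) (Q z0))))) H). }
destruct (hp_slope_continuous x0 m0 x0 m0 Hx0) as [S1 S2].
exists (fun x m => Re (Cmul (Q (hp_disk x m)) (hp_slope x0 m0 x m))),
       (fun x m => Im (Cmul (Q (hp_disk x m)) (hp_slope x0 m0 x m))).
split; [| split; [| split]].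
- apply continuity_2d_pt_minus; apply continuity_2d_pt_mult; assumption.
- apply continuity_2d_pt_plus; apply continuity_2d_pt_mult; assumption.
- fold z0; rewrite HQ0; reflexivity.
- intros x m Hx; rewrite HQ; unfold z0; rewrite (hp_disk_sub x0 m0 x m Hx0 Hx).
  unfold Cmul, Re, Im; simpl; f_equal; ring.
Qed.

(** * The level foliation of a harmonic shear *)

Lemma continuity_2d_pt_of_factor (u q1 q2 d1 d2 : R -> R -> R) (x0 m0 : R) :
  continuity_2d_pt q1 x0 m0 -> continuity_2d_pt q2 x0 m0 ->
  continuity_2d_pt d1 x0 m0 -> continuity_2d_pt d2 x0 m0 ->
  locally_2d (fun x m => u x m - u x0 m0 = q1 x m * d1 x m + q2 x m * d2 x m) x0 m0 ->
  continuity_2d_pt u x0 m0.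
Proof.
intros C1 C2 D1 D2 H.
apply continuity_2d_pt_ext_loc
  with (fun x m => u x0 m0 + (q1 x m * d1 x m + q2 x m * d2 x m)).
- revert H; apply locally_2d_impl, locally_2d_forall; intros x m E; lra.
- continuity_2d; assumption.
Qed.

Lemma hp_ratio_continuous (x0 m0 x m : R) :
  continuity_2d_pt (fun v w => Re (hp_ratio x0 m0 v w)) x m /\
  continuity_2d_pt (fun v w => Im (hp_ratio x0 m0 v w)) x m.
Proof.
unfold hp_ratio, Re, Im, Rdiv; simpl fst; simpl snd; split; continuity_2d.
Qed.

Lemma locally_2d_pos_left (x0 m0 : R) : 0 < x0 -> locally_2d (fun x _ => 0 < x) x0 m0.
Proof.
intros Hx0; exists (mkposreal _ Hx0); intros x m Hx _; apply Rabs_def2 in Hx; simpl in Hx; lra.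
Qed.

Lemma locally_2d_gt0 (q : R -> R -> R) (x0 m0 : R) :
  continuity_2d_pt q x0 m0 -> 0 < q x0 m0 -> locally_2d (fun x m => 0 < q x m) x0 m0.
Proof.
intros Hq Hpos; generalize (Hq (mkposreal _ Hpos)).
apply locally_2d_impl, locally_2d_forall; intros x m H; simpl in H.
apply Rabs_def2 in H; lra.
Qed.

(* On a level line of Re (h + g) the increment of h + g is imaginary, and
   |h'|^2 - |g'|^2 = Re ((h' - g') conj (h' + g')) > 0 then forces Im (h - g) to move in the
   same direction as m. *)
Lemma shear_foliation (h g : Cplx -> Cplx) :
  loc_univ_sense_pres h g ->
  (forall x m, 0 < x -> exists l, 0 < l /\
     derivable_pt_lim (fun v => Re (harm h g (hp_disk v m))) x l) ->
  (forall x m m', 0 < x -> exists x', 0 < x' /\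
     Re (harm h g (hp_disk x' m')) = Re (harm h g (hp_disk x m))) ->
  level_foliation (fun x m => Re (harm h g (hp_disk x m)))
                  (fun x m => Im (harm h g (hp_disk x m))).
Proof.
intros [Hh [Hg Hdil]] Hder Hfull.
(* The increments of [u] and [k] are linear forms in the real and imaginary parts of [hp_ratio]. The
   determinant of their coefficients is [h1^2 + h2^2 - (g1^2 + g2^2)], which the dilatation bound
   makes positive at the base point. *)
assert (Hloc : forall x0 m0, 0 < x0 -> exists h1 h2 g1 g2 : R -> R -> R,
  (continuity_2d_pt h1 x0 m0 /\ continuity_2d_pt h2 x0 m0 /\
   continuity_2d_pt g1 x0 m0 /\ continuity_2d_pt g2 x0 m0) /\
  0 < h1 x0 m0 ^ 2 + h2 x0 m0 ^ 2 - (g1 x0 m0 ^ 2 + g2 x0 m0 ^ 2) /\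
  (forall x m, 0 < x ->
     Re (harm h g (hp_disk x m)) - Re (harm h g (hp_disk x0 m0)) =
     (h1 x m + g1 x m) * Re (hp_ratio x0 m0 x m) +
     - (h2 x m + g2 x m) * Im (hp_ratio x0 m0 x m)) /\
  (forall x m, 0 < x ->
     Im (harm h g (hp_disk x m)) - Im (harm h g (hp_disk x0 m0)) =
     (h2 x m - g2 x m) * Re (hp_ratio x0 m0 x m) +
     (h1 x m - g1 x m) * Im (hp_ratio x0 m0 x m))).
{ intros x0 m0 Hx0; pose proof (hp_disk_inE x0 m0 Hx0) as HE.
  destruct (Hh _ HE) as [a Ha]; destruct (Hg _ HE) as [b Hb].
  destruct (Hdil _ a b HE Ha Hb) as [Ha0 Hab].
  destruct (has_cderiv_hp_disk h x0 m0 a Hx0 Ha) as [h1 [h2 [Ch1 [Ch2 [Eh Hh12]]]]].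
  destruct (has_cderiv_hp_disk g x0 m0 b Hx0 Hb) as [g1 [g2 [Cg1 [Cg2 [Eg Hg12]]]]].
  exists h1, h2, g1, g2; split; [tauto | split; [| split]].
  - assert (Hn : Re b ^ 2 + Im b ^ 2 < Re a ^ 2 + Im a ^ 2).
    { apply sqrt_lt_0_alt; change (Cmod b < Cmod a).
      assert (Hpa : 0 < Cmod a) by exact (Cnorm_gt0 a Ha0).
      change (Cmod (Complex.Cdiv b a) < 1) in Hab.
      rewrite Cmod_div in Hab by exact Ha0.
      apply (Rmult_lt_compat_r (Cmod a)) in Hab; [| exact Hpa].
      unfold Rdiv in Hab; rewrite Rmult_assoc, Rinv_l in Hab by lra; lra. }
    pose proof (hp_slope_neq0 x0 m0 Hx0) as Hs.
    set (s := hp_slope x0 m0 x0 m0) in *.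
    assert (E1 : h1 x0 m0 = Re a * Re s - Im a * Im s) by exact (f_equal Re Eh).
    assert (E2 : h2 x0 m0 = Re a * Im s + Im a * Re s) by exact (f_equal Im Eh).
    assert (E3 : g1 x0 m0 = Re b * Re s - Im b * Im s) by exact (f_equal Re Eg).
    assert (E4 : g2 x0 m0 = Re b * Im s + Im b * Re s) by exact (f_equal Im Eg).
    rewrite E1, E2, E3, E4.
    replace (_ - _) with ((Re a ^ 2 + Im a ^ 2 - (Re b ^ 2 + Im b ^ 2)) * (Re s ^ 2 + Im s ^ 2))
      by ring.
    apply Rmult_lt_0_compat; lra.
  - intros x m Hx; specialize (Hh12 x m Hx); specialize (Hg12 x m Hx).
    set (r := hp_ratio x0 m0 x m) in *.
    assert (E1 : Re (h (hp_disk x m)) - Re (h (hp_disk x0 m0)) =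
                 h1 x m * Re r - h2 x m * Im r)
      by exact (f_equal Re Hh12).
    assert (E2 : Re (g (hp_disk x m)) - Re (g (hp_disk x0 m0)) =
                 g1 x m * Re r - g2 x m * Im r)
      by exact (f_equal Re Hg12).
    change (Re (h (hp_disk x m)) + Re (g (hp_disk x m)) -
            (Re (h (hp_disk x0 m0)) + Re (g (hp_disk x0 m0))) =
            (h1 x m + g1 x m) * Re r + - (h2 x m + g2 x m) * Im r); lra.
  - intros x m Hx; specialize (Hh12 x m Hx); specialize (Hg12 x m Hx).
    set (r := hp_ratio x0 m0 x m) in *.
    assert (E1 : Im (h (hp_disk x m)) - Im (h (hp_disk x0 m0)) =
                 h1 x m * Im r + h2 x m * Re r)
      by exact (f_equal Im Hh12).
    assert (E2 : Im (g (hp_disk x m)) - Im (g (hp_disk x0 m0)) =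
                 g1 x m * Im r + g2 x m * Re r)
      by exact (f_equal Im Hg12).
    change (Im (h (hp_disk x m)) + - Im (g (hp_disk x m)) -
            (Im (h (hp_disk x0 m0)) + - Im (g (hp_disk x0 m0))) =
            (h2 x m - g2 x m) * Re r + (h1 x m - g1 x m) * Im r); lra. }
split.
- intros x0 m0 Hx0.
  destruct (Hloc x0 m0 Hx0) as [h1 [h2 [g1 [g2 [[C1 [C2 [C3 C4]]] [_ [Hu _]]]]]]].
  destruct (hp_ratio_continuous x0 m0 x0 m0) as [D1 D2].
  apply (continuity_2d_pt_of_factor _ (fun x m => h1 x m + g1 x m)
           (fun x m => - (h2 x m + g2 x m)) _ _ _ _
           (continuity_2d_pt_plus _ _ _ _ C1 C3)
           (continuity_2d_pt_opp _ _ _ (continuity_2d_pt_plus _ _ _ _ C2 C4)) D1 D2).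
  generalize (locally_2d_pos_left x0 m0 Hx0).
  apply locally_2d_impl, locally_2d_forall; exact Hu.
- intros x0 m0 Hx0.
  destruct (Hloc x0 m0 Hx0) as [h1 [h2 [g1 [g2 [[C1 [C2 [C3 C4]]] [_ [_ Hk]]]]]]].
  destruct (hp_ratio_continuous x0 m0 x0 m0) as [D1 D2].
  apply (continuity_2d_pt_of_factor _ (fun x m => h2 x m - g2 x m)
           (fun x m => h1 x m - g1 x m) _ _ _ _
           (continuity_2d_pt_minus _ _ _ _ C2 C4) (continuity_2d_pt_minus _ _ _ _ C1 C3)
           D1 D2).
  generalize (locally_2d_pos_left x0 m0 Hx0).
  apply locally_2d_impl, locally_2d_forall; exact Hk.
- intros m x1 x2 Hx.
  set (u := fun v => Re (harm h g (hp_disk v m))).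
  assert (Hu : forall v, x1 <= v <= x2 -> exists l, 0 < l /\ derivable_pt_lim u v l)
    by (intros v Hv; apply Hder; lra).
  destruct (MVT_gen u x1 x2 (Derive u)) as [v [Hv E]].
  + rewrite Rmin_left, Rmax_right by lra; intros v Hv.
    destruct (Hu v ltac:(lra)) as [l [_ Hl]].
    apply Derive_correct; exists l; apply is_derive_Reals; exact Hl.
  + rewrite Rmin_left, Rmax_right by lra; intros v Hv.
    destruct (Hu v ltac:(lra)) as [l [_ Hl]].
    apply derivable_continuous_pt; exists l; exact Hl.
  + rewrite Rmin_left, Rmax_right in Hv by lra.
    destruct (Hu v ltac:(lra)) as [l [Hl0 Hl]].
    rewrite (is_derive_unique u v l) in E by (apply is_derive_Reals; exact Hl).
    change (u x1 < u x2); nra.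
- exact Hfull.
- intros x0 m0 Hx0.
  destruct (Hloc x0 m0 Hx0) as [h1 [h2 [g1 [g2 [[C1 [C2 [C3 C4]]] [Hdet [Hu Hk]]]]]]].
  destruct (hp_ratio_continuous x0 m0 x0 m0) as [D1 D2].
  assert (Hm0 : 0 < 1 + m0 ^ 2) by nra.
  (* On the ray [m = m0] the ratio is the real number [(x - x0) / x0], so the derivative of [u]
     along the ray is [(h1 + g1) / x0], positive by [Hder]. *)
  assert (HA1 : 0 < h1 x0 m0 + g1 x0 m0).
  { destruct (Hder x0 m0 Hx0) as [l [Hl0 Hl]].
    assert (Hl' : derivable_pt_lim (fun v => Re (harm h g (hp_disk v m0))) x0
                    ((h1 x0 m0 + g1 x0 m0) / x0)).
    { intros eps Heps.
      assert (Hex : 0 < eps * x0) by nra.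
      destruct (continuity_2d_pt_plus h1 g1 x0 m0 C1 C3 (mkposreal _ Hex)) as [d Hd].
      simpl in Hd.
      assert (Hdd : 0 < Rmin d x0) by (apply Rmin_glb_lt; [apply cond_pos | lra]).
      exists (mkposreal _ Hdd); intros v Hv0 Hv; simpl in Hv.
      pose proof (Rlt_le_trans _ _ _ Hv (Rmin_l _ _)) as Hv1.
      pose proof (Rlt_le_trans _ _ _ Hv (Rmin_r _ _)) as Hv2.
      apply Rabs_def2 in Hv2.
      rewrite (Hu (x0 + v) m0) by lra.
      specialize (Hd (x0 + v) m0).
      replace (x0 + v - x0) with v in Hd by ring.
      rewrite Rminus_diag, Rabs_R0 in Hd; specialize (Hd Hv1 (cond_pos d)).
      unfold hp_ratio, Re, Im; simpl fst; simpl snd.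
      replace (_ / v - _) with
        ((h1 (x0 + v) m0 + g1 (x0 + v) m0 - (h1 x0 m0 + g1 x0 m0)) / x0)
        by (field; lra).
      unfold Rdiv; rewrite Rabs_mult, (Rabs_pos_eq (/ x0))
        by (left; apply Rinv_0_lt_compat; exact Hx0).
      apply (Rmult_lt_reg_r x0); [exact Hx0 |].
      rewrite Rmult_assoc, Rinv_l by lra; lra. }
    rewrite (uniqueness_limite _ _ _ _ Hl Hl') in Hl0.
    replace (h1 x0 m0 + g1 x0 m0) with ((h1 x0 m0 + g1 x0 m0) / x0 * x0) by (field; lra).
    apply Rmult_lt_0_compat; assumption. }
  assert (Cdet : continuity_2d_pt
            (fun x m => h1 x m ^ 2 + h2 x m ^ 2 - (g1 x m ^ 2 + g2 x m ^ 2)) x0 m0)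
    by (simpl pow; continuity_2d; assumption).
  generalize (locally_2d_and _ _ _ _ (locally_2d_pos_left x0 m0 Hx0)
    (locally_2d_and _ _ _ _
      (locally_2d_gt0 _ _ _ (continuity_2d_pt_plus h1 g1 x0 m0 C1 C3) HA1)
      (locally_2d_gt0 _ _ _ Cdet Hdet))).
  apply locally_2d_impl, locally_2d_forall; intros x m [Hx [Ha Hdt]] Hlev Hne.
  specialize (Hu x m Hx); specialize (Hk x m Hx).
  rewrite Hlev, Rminus_diag in Hu; rewrite Hk.
  set (r1 := Re (hp_ratio x0 m0 x m)) in *.
  assert (Er2 : Im (hp_ratio x0 m0 x m) = x / (x0 * (1 + m0 ^ 2)) * (m - m0))
    by (unfold hp_ratio, Im; simpl snd; field; lra).
  set (r2 := Im (hp_ratio x0 m0 x m)) in *.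
  (* Cramer's rule: [h1 + g1] times the increment of [k] is the determinant times [r2], plus
     [h2 - g2] times the increment of [u]. The latter vanishes on the level line, and [r2] has the
     sign of [m - m0]. *)
  apply (Rmult_lt_reg_l (h1 x m + g1 x m)); [exact Ha |]; rewrite Rmult_0_r.
  replace (_ * _) with
    ((h1 x m ^ 2 + h2 x m ^ 2 - (g1 x m ^ 2 + g2 x m ^ 2)) * r2 * (m - m0)
     + (h2 x m - g2 x m) * ((h1 x m + g1 x m) * r1 + - (h2 x m + g2 x m) * r2) * (m - m0))
    by ring.
  rewrite <- Hu, Er2, Rmult_0_r, Rmult_0_l, Rplus_0_r.
  replace (_ * _) with
    ((h1 x m ^ 2 + h2 x m ^ 2 - (g1 x m ^ 2 + g2 x m ^ 2)) *
     (x / (x0 * (1 + m0 ^ 2))) * (m - m0) ^ 2) by ring.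
  apply Rmult_lt_0_compat; [apply Rmult_lt_0_compat; [exact Hdt |] |].
  + apply Rdiv_lt_0_compat; [exact Hx | apply Rmult_lt_0_compat; assumption].
  + apply pow2_gt_0; lra.
Qed.

(** * Real parts of the two analytic sums in half-plane coordinates *)

(** The signs of cosine and sine locate [psi], and each branch of [Carg] applies the multiple of
    [PI] lost by [atan (tan psi)]; on the imaginary axis [psi] is read off directly. *)
Lemma Carg_polar (kappa psi : R) : 0 < kappa -> - PI < psi < PI ->
  Carg (kappa * cos psi, kappa * sin psi) = psi.
Proof.
intros Hk Hpsi; unfold Carg, Re, Im; simpl fst; simpl snd.
assert (Htan : forall a, cos a <> 0 -> kappa * sin a / (kappa * cos a) = tan a)
  by (intros a Ha; unfold tan; field; lra).
destruct (Rlt_dec 0 (kappa * cos psi)) as [H1 | H1].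
- assert (Hc : 0 < cos psi) by nra.
  rewrite Htan by lra; apply atan_tan; split; apply Rnot_le_lt; intros H.
  + assert (cos (- psi) <= 0) by (apply cos_le_0; lra); rewrite cos_neg in *; lra.
  + assert (cos psi <= 0) by (apply cos_le_0; lra); lra.
- assert (Hc : cos psi <= 0) by nra.
  destruct (Rlt_dec (kappa * cos psi) 0) as [H2 | H2].
  + assert (Hc' : cos psi < 0) by nra.
    rewrite Htan by lra.
    destruct (Rle_dec 0 (kappa * sin psi)) as [H3 | H3].
    * assert (Hs : 0 <= sin psi) by nra.
      assert (Hpos : 0 <= psi).
      { apply Rnot_lt_le; intros H; pose proof (sin_lt_0_var psi ltac:(lra) H); lra. }
      assert (Hgt : PI / 2 < psi).
      { apply Rnot_le_lt; intros H; pose proof (cos_ge_0 psi ltac:(lra) H); lra. }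
      replace (tan psi) with (tan (psi - PI)).
      { rewrite atan_tan by lra; ring. }
      unfold tan; rewrite sin_minus, cos_minus, cos_PI, sin_PI; field; lra.
    * assert (Hs : sin psi < 0) by nra.
      assert (Hneg : psi < 0).
      { apply Rnot_le_lt; intros H; pose proof (sin_ge_0 psi H ltac:(lra)); lra. }
      assert (Hgt : psi < - (PI / 2)).
      { apply Rnot_le_lt; intros H; pose proof (cos_ge_0 psi ltac:(lra) ltac:(lra)); lra. }
      replace (tan psi) with (tan (psi + PI)).
      { rewrite atan_tan by lra; ring. }
      unfold tan; rewrite sin_plus, cos_plus, cos_PI, sin_PI; field; lra.
  + assert (Hc' : cos psi = 0) by nra.
    destruct (Rle_or_lt 0 psi) as [Hp | Hp].
    * assert (E : psi = PI / 2).
      { destruct (Rtotal_order psi (PI / 2)) as [H | [H | H]]; [| exact H |].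
        - pose proof (cos_gt_0 psi ltac:(lra) H); lra.
        - pose proof (cos_lt_0 psi H ltac:(lra)); lra. }
      rewrite E, sin_PI2.
      destruct (Rlt_dec 0 (kappa * 1)); [reflexivity | lra].
    * assert (E : psi = - (PI / 2)).
      { rewrite <- (Ropp_involutive psi), cos_neg in Hc'.
        destruct (Rtotal_order (- psi) (PI / 2)) as [H | [H | H]]; [| lra |].
        - pose proof (cos_gt_0 (- psi) ltac:(lra) H); lra.
        - pose proof (cos_lt_0 (- psi) H ltac:(lra)); lra. }
      rewrite E, sin_neg, sin_PI2.
      destruct (Rlt_dec 0 (kappa * - (1))); [lra |].
      destruct (Rlt_dec (kappa * - (1)) 0); [reflexivity | lra].
Qed.

(** Division by [2 i sin th] turns the argument of the quotient [q] into the real part. The quotient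
    is a positive multiple of [exp(i psi)] with [psi = th - PI / 2 + atan X], and [psi] lies between
    [th - PI] and [th], so it is the principal argument. *)
Lemma Re_F_theta_hp_disk (th x m : R) : 0 < th < PI -> 0 < x ->
  Re (F_theta th (hp_disk x m)) =
  (th - PI / 2 +
   atan (((1 + cos th) * (x * (1 + m ^ 2)) - (1 - cos th) / x) / (2 * sin th)))
  / (2 * sin th).
Proof.
intros Hth Hx.
assert (HS : 0 < sin th) by (apply sin_gt_0; lra).
pose proof (sin2_cos2 th) as HSC; unfold Rsqr in HSC.
pose proof (hp_den_pos x m Hx) as Hd.
pose proof (proj1 (inE_sqr _) (hp_disk_inE x m Hx)) as HE.
pose proof (hp_disk_norm x m Hx) as Hn.
set (X := ((1 + cos th) * (x * (1 + m ^ 2)) - (1 - cos th) / x) / (2 * sin th)).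
set (z := hp_disk x m) in *.
set (q := Cdiv (Cadd (1, 0) (Cmul z (Cexpi th))) (Cadd (1, 0) (Cmul z (Cexpi (- th))))).
assert (EF : Re (F_theta th z) = Carg q / (2 * sin th)).
{ unfold F_theta; fold q; unfold Clog, Cmul, Cinv, Ci, RtoC, Re, Im; simpl; field; lra. }
rewrite EF; f_equal.
set (psi := th - PI / 2 + atan X).
assert (Epsi : cos psi = cos th * sin (atan X) + sin th * cos (atan X) /\
               sin psi = sin th * sin (atan X) - cos th * cos (atan X)).
{ unfold psi; replace (th - PI / 2 + atan X) with (- (PI / 2 - (th + atan X))) by ring.
  rewrite cos_neg, sin_neg, cos_shift, sin_shift, sin_plus, cos_plus; split; ring. }
destruct Epsi as [Ec Es].
pose proof (atan_bound X) as Hat.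
assert (Hsq : 0 < sqrt (1 + X ^ 2)) by (apply sqrt_lt_R0; nra).
(* [D] is [|z + exp(i th)|^2], equal to the squared modulus of the denominator of [q]; it could
   vanish only at a point of the unit circle. *)
set (D := (Re z + cos th) ^ 2 + (Im z + sin th) ^ 2).
assert (HD : 0 < D).
{ apply Rnot_le_lt; intros H; unfold D in H.
  pose proof (pow2_ge_0 (Re z + cos th)); pose proof (pow2_ge_0 (Im z + sin th)).
  assert (E1 : Re z + cos th = 0) by (apply Rsqr_0_uniq; unfold Rsqr; lra).
  assert (E2 : Im z + sin th = 0) by (apply Rsqr_0_uniq; unfold Rsqr; lra).
  replace (Re z) with (- cos th) in HE by lra; replace (Im z) with (- sin th) in HE by lra.
  nra. }
assert (Hq2 : hp_den x m * Re z = x ^ 2 * (1 + m ^ 2) - 1)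
  by (unfold z, hp_disk, Re; simpl fst; field; lra).
assert (Hn' : hp_den x m * (Re z ^ 2 + Im z ^ 2) = hp_den x m - 4 * x).
{ replace (Re z ^ 2 + Im z ^ 2) with (1 - 4 * x / hp_den x m) by lra; field; lra. }
assert (HX : 2 * x * sin th * X = (1 + cos th) * (x ^ 2 * (1 + m ^ 2)) - (1 - cos th))
  by (unfold X; field; lra).
(* [N1 + i N2] is the numerator of [q] times the conjugate of its denominator,
   [1 + 2 Re z exp(i th) + |z|^2 exp(2 i th)]. [E1] and [E2] identify it, up to the factor
   [hp_den x m], with [4 x sin th exp(i th) (X - i)]. *)
set (N1 := 1 + 2 * Re z * cos th + (Re z ^ 2 + Im z ^ 2) * (cos th ^ 2 - sin th ^ 2)).
set (N2 := 2 * sin th * (Re z + (Re z ^ 2 + Im z ^ 2) * cos th)).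
assert (E1 : hp_den x m * N1 = 4 * x * sin th * (cos th * X + sin th)).
{ replace (hp_den x m * N1) with
    (hp_den x m + 2 * (hp_den x m * Re z) * cos th
     + hp_den x m * (Re z ^ 2 + Im z ^ 2) * (cos th ^ 2 - sin th ^ 2))
    by (unfold N1; ring).
  rewrite Hn', Hq2.
  replace (4 * x * sin th * (cos th * X + sin th)) with
    (2 * cos th * (2 * x * sin th * X) + 4 * x * (sin th * sin th)) by ring.
  rewrite HX; unfold hp_den.
  replace (sin th ^ 2) with (1 - cos th * cos th) by lra.
  replace (sin th * sin th) with (1 - cos th * cos th) by lra; ring. }
assert (E2 : hp_den x m * N2 = 4 * x * sin th * (sin th * X - cos th)).
{ replace (hp_den x m * N2) with
    (2 * sin th * (hp_den x m * Re z + hp_den x m * (Re z ^ 2 + Im z ^ 2) * cos th))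
    by (unfold N2; ring).
  rewrite Hn', Hq2.
  replace (4 * x * sin th * (sin th * X - cos th)) with
    (2 * sin th * (2 * x * sin th * X) - 4 * x * sin th * cos th) by ring.
  rewrite HX; unfold hp_den; ring. }
assert (Eq : q = (N1 / D, N2 / D)).
{ assert (HD' : (1 + (Re z * cos th + Im z * sin th)) ^ 2
                + (Im z * cos th - Re z * sin th) ^ 2 = D).
  { unfold D.
    replace ((1 + (Re z * cos th + Im z * sin th)) ^ 2
                + (Im z * cos th - Re z * sin th) ^ 2) with
      (1 + 2 * Re z * cos th + 2 * Im z * sin th
       + (Re z ^ 2 + Im z ^ 2) * (sin th * sin th + cos th * cos th)) by ring.
    replace ((Re z + cos th) ^ 2 + (Im z + sin th) ^ 2) with
      (2 * Re z * cos th + 2 * Im z * sin th + (Re z ^ 2 + Im z ^ 2)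
       + (sin th * sin th + cos th * cos th)) by ring.
    rewrite HSC; ring. }
  set (n1 := 1 + (Re z * cos th - Im z * sin th)).
  set (n2 := 0 + (Re z * sin th + Im z * cos th)).
  set (d1 := 1 + (Re z * cos th + Im z * sin th)) in *.
  set (d2 := Im z * cos th - Re z * sin th) in *.
  assert (En : Cadd (1, 0) (Cmul z (Cexpi th)) = (n1, n2)) by reflexivity.
  assert (Ed : Cadd (1, 0) (Cmul z (Cexpi (- th))) = (d1, d2)).
  { unfold Cexpi; rewrite cos_neg, sin_neg.
    unfold Cadd, Cmul, d1, d2, Re, Im; simpl fst; simpl snd; f_equal; ring. }
  unfold q; rewrite En, Ed.
  transitivity ((n1 * d1 + n2 * d2) / D, (n2 * d1 - n1 * d2) / D).
  - rewrite <- HD'; unfold Cdiv, Cmul, Cinv; simpl Re; simpl Im; f_equal; field; lra.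
  - f_equal; f_equal; unfold n1, n2, d1, d2, N1, N2; ring. }
(* The modulus of [q], since [|X - i| = sqrt (1 + X^2)]. *)
set (kappa := 4 * x * sin th * sqrt (1 + X ^ 2) / (hp_den x m * D)).
assert (Hk : 0 < kappa).
{ apply Rdiv_lt_0_compat; [| apply Rmult_lt_0_compat; assumption].
  repeat apply Rmult_lt_0_compat; lra. }
rewrite sin_atan, cos_atan in Ec, Es; unfold Rsqr in Ec, Es.
replace (1 + X * X) with (1 + X ^ 2) in Ec, Es by ring.
replace q with (kappa * cos psi, kappa * sin psi).
- apply Carg_polar; [exact Hk | unfold psi; lra].
- rewrite Eq, Ec, Es; unfold kappa; f_equal.
  + replace N1 with (hp_den x m * N1 / hp_den x m) by (field; lra); rewrite E1; field; lra.
  + replace N2 with (hp_den x m * N2 / hp_den x m) by (field; lra); rewrite E2; field; lra.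
Qed.

(** In terms of [p] the function is [((1 - al) p - (1 + al) / p) / 4 + al / 2], and
    [Re (1 / p) = 1 / (x (1 + m^2))]. *)
Lemma Re_F_alpha_hp_disk (al x m : R) : 0 < x ->
  Re (F_alpha al (hp_disk x m)) =
  ((1 - al) * x - (1 + al) / (x * (1 + m ^ 2))) / 4 + al / 2.
Proof.
intros Hx.
set (p := (x, x * m) : Complex.C).
assert (Hm : 0 < 1 + m ^ 2) by nra.
assert (Hp : p <> 0%C) by (intros E; injection E; lra).
assert (Hp1 : Cplus p 1 <> 0%C) by (intros E; injection E; lra).
assert (Ez : hp_disk x m = Complex.Cdiv (Cminus p 1) (Cplus p 1)).
{ pose proof (hp_den_pos x m Hx) as Hd; unfold hp_den in Hd.
  unfold hp_disk, hp_den, p, Complex.Cdiv, Cminus, Complex.Copp, Cplus, Cmult, Complex.Cinv,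
    Complex.RtoC; simpl fst; simpl snd.
  f_equal; field; repeat split; nra. }
assert (EF : F_alpha al (hp_disk x m) =
  Cplus (Cmult (Complex.RtoC (/ 4))
    (Cminus (Cmult (Complex.RtoC (1 - al)) p) (Cmult (Complex.RtoC (1 + al)) (Complex.Cinv p))))
    (Complex.RtoC (al / 2))).
{ rewrite Ez; unfold F_alpha.
  change (Complex.Cdiv (Cmult (Complex.Cdiv (Cminus p 1) (Cplus p 1))
       (Cminus 1 (Cmult (Complex.RtoC al) (Complex.Cdiv (Cminus p 1) (Cplus p 1)))))
     (Cminus 1 (Cmult (Complex.Cdiv (Cminus p 1) (Cplus p 1))
                      (Complex.Cdiv (Cminus p 1) (Cplus p 1)))) =
   Cplus (Cmult (Complex.RtoC (/ 4))
    (Cminus (Cmult (Complex.RtoC (1 - al)) p) (Cmult (Complex.RtoC (1 + al)) (Complex.Cinv p))))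
    (Complex.RtoC (al / 2))).
  unfold Rdiv; rewrite RtoC_minus, RtoC_plus, RtoC_mult, !RtoC_inv by lra.
  field; split; [exact Hp | split; [exact Hp1 |]].
  intros E; apply (f_equal fst) in E; simpl in E; nra. }
rewrite EF; unfold p, Re, Cplus, Cmult, Cminus, Complex.Copp, Complex.Cinv, Complex.RtoC;
  simpl fst; simpl snd.
field; repeat split; nra.
Qed.

(** * Monotonicity and range of the combined real part *)

(* Re (t F_theta + (1 - t) F_alpha) at p, with x = Re p and y = |p|^2 / Re p. *)
Definition shear_height (th al t x y : R) : R :=
  t * ((th - PI / 2 + atan (((1 + cos th) * y - (1 - cos th) / x) / (2 * sin th)))
       / (2 * sin th))
  + (1 - t) * (((1 - al) * x - (1 + al) / y) / 4 + al / 2).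

(** The terms [y], [- 1 / x], [x] and [- 1 / y] are increasing, and their coefficients involve only
    the nonnegative numbers [1 + cos th], [1 - cos th], [1 - al] and [1 + al]. *)
Lemma shear_height_le (th al t x y x' y' : R) :
  0 < th < PI -> -1 <= al <= 1 -> 0 <= t <= 1 -> 0 < x <= x' -> 0 < y <= y' ->
  shear_height th al t x y <= shear_height th al t x' y'.
Proof.
intros Hth Hal Ht Hx Hy; unfold shear_height.
assert (HS : 0 < sin th) by (apply sin_gt_0; lra).
pose proof (COS_bound th) as HC.
assert (Hix : / x' <= / x) by (apply Rinv_le_contravar; lra).
assert (Hiy : / y' <= / y) by (apply Rinv_le_contravar; lra).
assert (HiS : 0 < / (2 * sin th)) by (apply Rinv_0_lt_compat; lra).
apply Rplus_le_compat; apply Rmult_le_compat_l; try lra.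
- apply Rmult_le_compat_r; [lra |]; apply Rplus_le_compat_l.
  assert (Harg : ((1 + cos th) * y - (1 - cos th) / x) / (2 * sin th) <=
                 ((1 + cos th) * y' - (1 - cos th) / x') / (2 * sin th))
    by (apply Rmult_le_compat_r; [lra | unfold Rdiv; nra]).
  destruct Harg as [H | ->]; [left; apply atan_increasing; exact H | lra].
- unfold Rdiv; nra.
Qed.

Lemma shear_height_derivative (th al t x m : R) :
  0 < th < PI -> -1 <= al <= 1 -> 0 <= t <= 1 -> 0 < x ->
  exists l, 0 < l /\
    derivable_pt_lim (fun v => shear_height th al t v (v * (1 + m ^ 2))) x l.
Proof.
intros Hth Hal Ht Hx.
assert (HS : 0 < sin th) by (apply sin_gt_0; lra).
assert (HC : -1 < cos th < 1).
{ pose proof (sin2_cos2 th) as HSC; unfold Rsqr in HSC.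
  assert (0 < sin th * sin th) by (apply Rmult_lt_0_compat; assumption).
  pose proof (COS_bound th); split; nra. }
assert (Hm : 0 < 1 + m ^ 2) by nra.
set (X := ((1 + cos th) * (x * (1 + m ^ 2)) - (1 - cos th) / x) / (2 * sin th)).
(* [A] and [B] are the derivatives along the ray of the two summands without their weights. [A] is
   positive because [|cos th| < 1], [B] because [1 - al] and [1 + al] are nonnegative with sum 2. *)
set (A := ((1 + cos th) * (1 + m ^ 2) + (1 - cos th) / x ^ 2) / (2 * sin th)
          / (1 + X ^ 2) / (2 * sin th)).
set (B := ((1 - al) + (1 + al) / (x ^ 2 * (1 + m ^ 2))) / 4).
assert (HX : 0 < 1 + X ^ 2) by nra.
assert (HA : 0 < A).
{ unfold A; repeat (apply Rdiv_lt_0_compat; [| lra]).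
  apply Rplus_lt_0_compat; [apply Rmult_lt_0_compat; lra |].
  apply Rdiv_lt_0_compat; [lra | nra]. }
assert (HB : 0 < B).
{ unfold B; apply Rdiv_lt_0_compat; [| lra].
  assert (Hi : 0 < / (x ^ 2 * (1 + m ^ 2)))
    by (apply Rinv_0_lt_compat; apply Rmult_lt_0_compat; nra).
  unfold Rdiv; destruct (Rlt_dec al 1); nra. }
exists (t * A + (1 - t) * B); split; [destruct (Rlt_dec 0 t); nra |].
apply is_derive_Reals; unfold shear_height; auto_derive.
- split; [lra | split; [| exact I]].
  apply Rgt_not_eq, Rmult_lt_0_compat; [exact Hx | exact Hm].
- assert (0 < (x * (2 * sin th)) ^ 2) by (apply pow_lt; nra).
  unfold A, B, X; field; repeat split; try lra.
  apply Rgt_not_eq, Rplus_lt_le_0_compat; [assumption | apply pow2_ge_0].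
Qed.

(** Write [y = x (1 + m^2)]. On the ray [m'] the abscissa [x / (1 + m'^2)] has second coordinate
    [x], so both coordinates are at most those of [(x, y)]; at the abscissa [y] both are at least as
    large. Monotonicity brackets the value, and it is attained in between. *)
Lemma shear_height_full (th al t x m m' : R) :
  0 < th < PI -> -1 <= al <= 1 -> 0 <= t <= 1 -> 0 < x ->
  exists x', 0 < x' /\
    shear_height th al t x' (x' * (1 + m' ^ 2)) = shear_height th al t x (x * (1 + m ^ 2)).
Proof.
intros Hth Hal Ht Hx.
assert (Hm : 1 <= 1 + m ^ 2) by nra; assert (Hm' : 1 <= 1 + m' ^ 2) by nra.
assert (Hlo : 0 < x / (1 + m' ^ 2)) by (apply Rdiv_lt_0_compat; lra).
assert (Elo : x / (1 + m' ^ 2) * (1 + m' ^ 2) = x) by (field; lra).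
assert (Hlo' : x / (1 + m' ^ 2) <= x).
{ rewrite <- Elo at 2; rewrite <- (Rmult_1_r (x / _)) at 1.
  apply Rmult_le_compat_l; lra. }
assert (Hhi : x <= x * (1 + m ^ 2)) by nra.
assert (Hhi' : x * (1 + m ^ 2) <= x * (1 + m ^ 2) * (1 + m' ^ 2)).
{ rewrite <- (Rmult_1_r (x * _)) at 1; apply Rmult_le_compat_l; lra. }
destruct (ivt_positive (fun v => shear_height th al t v (v * (1 + m' ^ 2)))
            (x / (1 + m' ^ 2)) (x * (1 + m ^ 2))
            (shear_height th al t x (x * (1 + m ^ 2)))) as [x' [Hx' E]].
- lra.
- intros v Hv; destruct (shear_height_derivative th al t v m' Hth Hal Ht Hv) as [l [_ Hl]].
  apply derivable_continuous_pt; exists l; exact Hl.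
- split; apply shear_height_le; try assumption; rewrite ?Elo; lra.
- exists x'; split; [lra | exact E].
Qed.

(** * Convex combinations of the two mappings *)

(** The error of the combined quotient is a convex combination of the two errors, so the same [eps]
    serves for both. *)
Lemma has_cderiv_comb (t : R) (u v : Cplx -> Cplx) (z a b : Cplx) : 0 <= t <= 1 ->
  has_cderiv u z a -> has_cderiv v z b ->
  has_cderiv (comb t u v) z (Cadd (Cmul (RtoC t) a) (Cmul (RtoC (1 - t)) b)).
Proof.
intros Ht Hu Hv eps Heps.
destruct (Hu eps Heps) as [d1 [Hd1 H1]]; destruct (Hv eps Heps) as [d2 [Hd2 H2]].
exists (Rmin d1 d2); split; [apply Rmin_glb_lt; assumption |]; intros w [Hw0 Hw].
specialize (H1 w (conj Hw0 (Rlt_le_trans _ _ _ Hw (Rmin_l _ _)))).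
specialize (H2 w (conj Hw0 (Rlt_le_trans _ _ _ Hw (Rmin_r _ _)))).
set (e1 := Csub (Cdiv (Csub (u w) (u z)) (Csub w z)) a) in *.
set (e2 := Csub (Cdiv (Csub (v w) (v z)) (Csub w z)) b) in *.
replace (Csub (Cdiv (Csub (comb t u v w) (comb t u v z)) (Csub w z)) _)
  with (Cadd (Cmul (RtoC t) e1) (Cmul (RtoC (1 - t)) e2)).
- apply Rle_lt_trans with (Cnorm (Cmul (RtoC t) e1) + Cnorm (Cmul (RtoC (1 - t)) e2));
    [exact (Cmod_triangle _ _) |].
  replace (Cnorm (Cmul (RtoC t) e1)) with (t * Cnorm e1)
    by (symmetry; rewrite <- (Rabs_pos_eq t) at 2 by lra; rewrite <- Cmod_R;
        exact (Cmod_mult _ _)).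
  replace (Cnorm (Cmul (RtoC (1 - t)) e2)) with ((1 - t) * Cnorm e2)
    by (symmetry; rewrite <- (Rabs_pos_eq (1 - t)) at 2 by lra; rewrite <- Cmod_R;
        exact (Cmod_mult _ _)).
  destruct (Rlt_dec 0 t); nra.
- unfold e1, e2, comb, Cdiv; set (i := Cinv (Csub w z)).
  unfold Csub, Cadd, Cmul, Copp, RtoC, Re, Im; simpl; f_equal; ring.
Qed.

Lemma Re_harm_comb_hp_disk (th al t x m : R) (hth gth hal gal : Cplx -> Cplx) :
  0 < th < PI -> 0 < x ->
  (forall z, inE z -> Cadd (hth z) (gth z) = F_theta th z) ->
  (forall z, inE z -> Cadd (hal z) (gal z) = F_alpha al z) ->
  Re (harm (comb t hth hal) (comb t gth gal) (hp_disk x m)) =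
  shear_height th al t x (x * (1 + m ^ 2)).
Proof.
intros Hth Hx Fth Fal.
pose proof (hp_disk_inE x m Hx) as HE.
unfold shear_height.
rewrite <- (Re_F_theta_hp_disk th x m Hth Hx), <- (Re_F_alpha_hp_disk al x m Hx).
rewrite <- (Fth _ HE), <- (Fal _ HE).
unfold harm, comb, Cadd, Cmul, Cconj, RtoC, Re, Im; simpl; ring.
Qed.

Theorem theorem2p12 (th al t : R) (hth gth hal gal : Cplx -> Cplx) :
  0 < th < PI ->
  in_SH hth gth ->
  (forall z, inE z -> Cadd (hth z) (gth z) = F_theta th z) ->
  -1 <= al <= 1 ->
  in_SH hal gal ->
  (forall z, inE z -> Cadd (hal z) (gal z) = F_alpha al z) ->
  0 <= t <= 1 ->
  loc_univ_sense_pres (comb t hth hal) (comb t gth gal) ->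
  in_SH (comb t hth hal) (comb t gth gal) /\
  domain (image_E (harm (comb t hth hal) (comb t gth gal))) /\
  convex_imag_dir (image_E (harm (comb t hth hal) (comb t gth gal))).
Proof.
intros Hth [_ [_ [Zth Dth]]] Fth Hal [_ [_ [Zal Dal]]] Fal Ht Hloc.
set (h := comb t hth hal) in *; set (g := comb t gth gal) in *.
assert (Hre : forall x m, 0 < x ->
          Re (harm h g (hp_disk x m)) = shear_height th al t x (x * (1 + m ^ 2)))
  by (intros; apply Re_harm_comb_hp_disk; assumption).
set (u := fun x m => Re (harm h g (hp_disk x m))).
set (k := fun x m => Im (harm h g (hp_disk x m))).
assert (Hfol : level_foliation u k).
{ apply shear_foliation; [exact Hloc | |].
  - intros x m Hx.
    destruct (shear_height_derivative th al t x m Hth Hal Ht Hx) as [l [Hl Hd]].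
    exists l; split; [exact Hl |].
    apply is_derive_Reals; apply is_derive_Reals in Hd.
    apply is_derive_ext_loc with (2 := Hd).
    (* The formula [Hre] is available for positive [v] only, hence the ball of radius [x] about
       [x]. *)
    exists (mkposreal x Hx); intros v Hv; symmetry; apply Hre.
    apply Rabs_def2 in Hv; unfold minus, plus, opp in Hv; simpl in Hv; lra.
  - intros x m m' Hx.
    destruct (shear_height_full th al t x m m' Hth Hal Ht Hx) as [x' [Hx' E]].
    exists x'; split; [exact Hx' |]; rewrite !Hre by assumption; exact E. }
assert (Himg : forall w, image_E (harm h g) w <->
          exists x m, 0 < x /\ u x m = Re w /\ k x m = Im w).
{ intros w; split.
  - intros [z [Hz <-]]; destruct (hp_disk_surj z Hz) as [x [m [Hx <-]]].
    exists x, m; repeat split; exact Hx.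
  - intros [x [m [Hx [Hu Hk]]]]; exists (hp_disk x m); split; [apply hp_disk_inE, Hx |].
    destruct w as [a b]; change (harm h g (hp_disk x m) = (Re (a, b), Im (a, b))).
    rewrite <- Hu, <- Hk; reflexivity. }
split; [| split].
- split; [exact Hloc | split; [| split]].
  + intros z1 z2 Hz1 Hz2 E.
    destruct (hp_disk_surj z1 Hz1) as [x1 [m1 [Hx1 <-]]].
    destruct (hp_disk_surj z2 Hz2) as [x2 [m2 [Hx2 <-]]].
    destruct (foliation_injective u k x1 m1 x2 m2 Hfol Hx1 Hx2) as [-> ->];
      [exact (f_equal Re E) | exact (f_equal Im E) | reflexivity].
  + apply (f_equal Re) in Zth as Z1; apply (f_equal Im) in Zth as Z2.
    apply (f_equal Re) in Zal as Z3; apply (f_equal Im) in Zal as Z4.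
    unfold harm, h, g, comb, Cadd, Cmul, Cconj, RtoC, Re, Im in *; simpl in *.
    f_equal; nra.
  + replace ((1, 0) : Cplx) with (Cadd (Cmul (RtoC t) (1, 0)) (Cmul (RtoC (1 - t)) (1, 0)))
      by (unfold Cadd, Cmul, RtoC, Re, Im; simpl; f_equal; ring).
    apply has_cderiv_comb; assumption.
- split; [| split].
  + intros w Hw; apply Himg in Hw; destruct Hw as [x0 [m0 [Hx0 [Hu Hk]]]].
    destruct (foliation_open u k x0 m0 Hfol Hx0) as [r [Hr Hopen]].
    exists r; split; [exact Hr |]; intros v Hv; apply Himg.
    destruct (Cnorm_bounds (Csub v w)) as [B1 [B2 _]].
    apply Hopen; [rewrite Hu | rewrite Hk];
      [exact (Rle_lt_trans _ _ _ B1 Hv) | exact (Rle_lt_trans _ _ _ B2 Hv)].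
  + intros w1 w2 Hw1 Hw2; apply Himg in Hw1; apply Himg in Hw2.
    destruct Hw1 as [x1 [m1 [Hx1 [Hu1 Hk1]]]]; destruct Hw2 as [x2 [m2 [Hx2 [Hu2 Hk2]]]].
    (* The path is the image of a straight segment in the coordinates [(x, m)], whose range [x > 0]
       is convex. *)
    set (xs := fun s => x1 + s * (x2 - x1)); set (ms := fun s => m1 + s * (m2 - m1)).
    assert (Hxs : forall s, 0 <= s <= 1 -> 0 < xs s) by (intros s Hs; unfold xs; nra).
    assert (Hcx : forall s, continuity_pt xs s) by (intros s; unfold xs; reg).
    assert (Hcm : forall s, continuity_pt ms s) by (intros s; unfold ms; reg).
    exists (fun s => (u (xs s) (ms s), k (xs s) (ms s))).
    assert (Eends : xs 0 = x1 /\ ms 0 = m1 /\ xs 1 = x2 /\ ms 1 = m2)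
      by (unfold xs, ms; repeat split; ring).
    destruct Eends as [-> [-> [-> ->]]].
    split; [destruct w1; f_equal; assumption | split; [destruct w2; f_equal; assumption | split]].
    * intros s Hs; apply Himg; exists (xs s), (ms s); repeat split; apply Hxs, Hs.
    * intros s Hs; split.
      -- apply (continuity_2d_pt_comp u xs ms); auto; apply (fol_cont_u u k Hfol), Hxs, Hs.
      -- apply (continuity_2d_pt_comp k xs ms); auto; apply (fol_cont_k u k Hfol), Hxs, Hs.
  (* [x = 1], [m = 0] is [p = 1], the centre of the disk. *)
  + exists (u 1 0, k 1 0); apply Himg; exists 1, 0; repeat split; lra.
- intros w1 w2 Hw1 Hw2 Hre12 y Hy; apply Himg in Hw1; apply Himg in Hw2; apply Himg.
  destruct Hw1 as [x1 [m1 [Hx1 [Hu1 Hk1]]]]; destruct Hw2 as [x2 [m2 [Hx2 [Hu2 Hk2]]]].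
  rewrite <- Hk1, <- Hk2 in Hy; unfold Re at 1; simpl fst; rewrite <- Hu1.
  apply (foliation_vertical_convex u k x1 m1 x2 m2 y); try assumption; congruence.
Qed.
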